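(* Let $K$ be any field. Let $G$ and $H$ be Lie nilpotent associative algebras over $K$ of indices respectively $p_1$ and $p_2$, such that $H$ also satisfies the identity $[x_1,x_2][x_3,x_4]\cdots[x_{2k-1},x_{2k}]=0$ for some integer $k\geq 2$. Then $G\otimes H$ is again Lie nilpotent. Moreover, if $q$ is the minimal integer such that $[x_1,\dots,x_{q+1}]=0$ is an identity for $G\otimes H$, then $$\max\{p_1,p_2\}\leq q\leq 4(p_1+p_2+k-2).$$ When $\operatorname{char}K\neq 3$, there is a better upper bound for $q$, namely $$\max\{p_1,p_2\}\leq q\leq 4\left(\left\lceil\frac{p_1-1}{2}\right\rceil+\left\lceil\frac{p_2-1}{2}\right\rceil+k\right).$$
   Context: All algebras are unital associative $K$-algebras and $\otimes=\otimes_K$. Long commutators are left-normed: $[u_1,u_2]=u_1u_2-u_2u_1$ and $[u_1,\dots,u_{m+1}]=[[u_1,\dots,u_m],u_{m+1}]$ for $m\ge 2$ (and a commutator of length $1$ is $[u_1]=u_1$). An algebra $A$ satisfies the identity $f(x_1,\dots,x_m)=0$, where $f$ is a polynomial in noncommuting variables, if $f(a_1,\dots,a_m)=0$ for all $a_i\in A$. $A$ is Lie nilpotent if it satisfies $[x_1,\dots,x_{p+1}]=0$ for some $p\geq 1$. It is of index $p$ if it satisfies $[x_1,\dots,x_{p+1}]=0$ and does not satisfy $[x_1,\dots,x_p]=0$. *)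

(* Defs.v *)
From HB Require Import structures.
From mathcomp Require Import all_boot all_algebra generic_quotient.
From mathcomp Require Import boolp classical_sets.

Set Implicit Arguments.
Unset Strict Implicit.
Unset Printing Implicit Defensive.

Import GRing.Theory.
Local Open Scope ring_scope.
Local Open Scope quotient_scope.

Section TensorProduct.
Variables (K : fieldType) (G H : algType K).

(* A sequence of pairs (g_i, h_i) stands for the formal sum of the g_i (x) h_i.
   Scalars need no separate treatment, since a(g (x) h) = (a g) (x) h.        *)
Inductive tensor_eq : seq (G * H) -> seq (G * H) -> Prop :=
| TensorRefl s : tensor_eq s s
| TensorSym s t : tensor_eq s t -> tensor_eq t s
| TensorTrans s t u : tensor_eq s t -> tensor_eq t u -> tensor_eq s u
| TensorCat s s' t t' :
    tensor_eq s s' -> tensor_eq t t' -> tensor_eq (s ++ t) (s' ++ t')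
| TensorSwap s t : tensor_eq (s ++ t) (t ++ s)
| TensorZero h : tensor_eq [:: (0, h)] [::]
| TensorAddl g g' h : tensor_eq [:: (g + g', h)] [:: (g, h); (g', h)]
| TensorAddr g h h' : tensor_eq [:: (g, h + h')] [:: (g, h); (g, h')]
| TensorScale a g h : tensor_eq [:: (a *: g, h)] [:: (g, a *: h)].

Definition tensor_rel : rel (seq (G * H)) := fun s t => `[< tensor_eq s t >].

Fact tensor_rel_refl : reflexive tensor_rel.
Proof. by move=> s; apply/asboolP/TensorRefl. Qed.

Fact tensor_rel_sym : symmetric tensor_rel.
Proof. by move=> s t; apply/asboolP/asboolP; apply: TensorSym. Qed.

Fact tensor_rel_trans : transitive tensor_rel.
Proof.
by move=> t s u /asboolP st /asboolP tu; apply/asboolP/(TensorTrans st tu).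
Qed.

Canonical tensor_equiv_rel :=
  EquivRel tensor_rel tensor_rel_refl tensor_rel_sym tensor_rel_trans.

Definition tensor := {eq_quot tensor_rel}.

HB.instance Definition _ := Choice.on tensor.
HB.instance Definition _ := EqQuotient.on tensor.

Definition tens (g : G) (h : H) : tensor := \pi_tensor [:: (g, h)].

Lemma tensor_piP s t : tensor_eq s t <-> \pi_tensor s = \pi_tensor t.
Proof.
split=> [st|/eqP]; first by apply/eqP; rewrite piE; apply/asboolP.
by rewrite piE => /asboolP.
Qed.

Lemma tensor_reprP s : tensor_eq (repr (\pi_tensor s)) s.
Proof. by apply/tensor_piP; rewrite reprK. Qed.

Definition tensor_zero : tensor := \pi_tensor [::].
Definition tensor_add (u v : tensor) : tensor := \pi_tensor (repr u ++ repr v).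
Definition tensor_opp (u : tensor) : tensor :=
  \pi_tensor [seq (- x.1, x.2) | x <- repr u].

Lemma tensor_addE s t :
  tensor_add (\pi_tensor s) (\pi_tensor t) = \pi_tensor (s ++ t).
Proof. by apply/tensor_piP/TensorCat; apply: tensor_reprP. Qed.

Lemma tensor_eq_opp s t : tensor_eq s t ->
  tensor_eq [seq (- x.1, x.2) | x <- s] [seq (- x.1, x.2) | x <- t].
Proof.
elim=> [{}s|{}s {}t _|{}s {}t u _ + _|s1 s2 t1 t2 _ + _|s1 s2|h|g g' h|g h h'|a g h].
- exact: TensorRefl.
- exact: TensorSym.
- exact: TensorTrans.
- by rewrite !map_cat; apply: TensorCat.
- by rewrite !map_cat; apply: TensorSwap.
- by rewrite /= oppr0; apply: TensorZero.
- by rewrite /= opprD; apply: TensorAddl.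
- exact: TensorAddr.
- by rewrite /= -scalerN; apply: TensorScale.
Qed.

Fact tensor_addA : associative tensor_add.
Proof.
elim/quotW=> s; elim/quotW=> t; elim/quotW=> u.
by rewrite (tensor_addE s t) (tensor_addE t u) !tensor_addE catA.
Qed.

Fact tensor_addC : commutative tensor_add.
Proof. by move=> u v; apply/tensor_piP/TensorSwap. Qed.

Fact tensor_add0 : left_id tensor_zero tensor_add.
Proof. by elim/quotW=> s; apply: (tensor_addE [::] s). Qed.

Fact tensor_addN : left_inverse tensor_zero tensor_opp tensor_add.
Proof.
move=> u; rewrite -{2}[u]reprK; apply: etrans (tensor_addE _ _) _.
apply/tensor_piP; elim: (repr u) => [|[g h] s IHs] /=; first exact: TensorRefl.
have E : tensor_eq [:: (- g, h); (g, h)] [::].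
  apply: TensorTrans (TensorZero h); rewrite -(addNr g).
  exact/TensorSym/TensorAddl.
set s' := map _ s in IHs *.
apply: (@TensorTrans _ ([:: (- g, h)] ++ (([:: (g, h)] ++ s) ++ s'))).
  exact: (@TensorCat [:: _] _ (s' ++ _) _ (TensorRefl _) (TensorSwap _ _)).
rewrite -catA catA; apply: (TensorCat E).
exact: TensorTrans (TensorSwap _ _) IHs.
Qed.

HB.instance Definition _ :=
  GRing.isZmodule.Build tensor tensor_addA tensor_addC tensor_add0 tensor_addN.

Lemma pi_tensorE s : \pi_tensor s = \sum_(x <- s) tens x.1 x.2.
Proof.
elim: s => [|[g h] s IHs]; first by rewrite big_nil.
by rewrite big_cons -IHs; apply/esym/(tensor_addE [:: _]).
Qed.

Lemma tensor_reprE (u : tensor) : u = \sum_(x <- repr u) tens x.1 x.2.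
Proof. by rewrite -pi_tensorE reprK. Qed.

Lemma tensDl g g' h : tens (g + g') h = tens g h + tens g' h.
Proof.
apply: etrans (proj1 (tensor_piP _ _) (TensorAddl g g' h)) _.
by rewrite pi_tensorE !big_cons big_nil addr0.
Qed.

Lemma tensDr g h h' : tens g (h + h') = tens g h + tens g h'.
Proof.
apply: etrans (proj1 (tensor_piP _ _) (TensorAddr g h h')) _.
by rewrite pi_tensorE !big_cons big_nil addr0.
Qed.

Lemma tensZlr a g h : tens (a *: g) h = tens g (a *: h).
Proof. by apply/tensor_piP/TensorScale. Qed.

Lemma tensor_ind (P : tensor -> Prop) :
  P 0 -> (forall u v, P u -> P v -> P (u + v)) ->
  (forall g h, P (tens g h)) -> forall u, P u.
Proof. by move=> P0 PD Pt u; rewrite (tensor_reprE u); apply: big_ind. Qed.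

(* Universal property, in its additive form. *)
Section Lift.
Variables (V : zmodType) (b : G -> H -> V).
Hypothesis bDl : forall g g' h, b (g + g') h = b g h + b g' h.
Hypothesis bDr : forall g h h', b g (h + h') = b g h + b g h'.
Hypothesis bZ : forall a g h, b (a *: g) h = b g (a *: h).

Lemma tensor_eq_sum s t : tensor_eq s t ->
  \sum_(x <- s) b x.1 x.2 = \sum_(x <- t) b x.1 x.2.
Proof.
elim=> [//|//|{}s {}t u _ -> _ -> //|s1 s2 t1 t2 _ + _|s1 s2|h|g g' h|g h h'|a g h];
  rewrite ?big_cat /= ?big_cons ?big_nil ?addr0 //=.
- by move=> -> ->.
- by rewrite addrC.
- by apply: (addrI (b 0 h)); rewrite -bDl !addr0.
Qed.

Definition tensor_lift (u : tensor) : V := \sum_(x <- repr u) b x.1 x.2.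

Lemma tensor_lift_tens g h : tensor_lift (tens g h) = b g h.
Proof.
rewrite /tensor_lift (tensor_eq_sum (tensor_reprP _)).
by rewrite big_cons big_nil addr0.
Qed.

Lemma tensor_liftD u v : tensor_lift (u + v) = tensor_lift u + tensor_lift v.
Proof. by rewrite /tensor_lift (tensor_eq_sum (tensor_reprP _)) big_cat. Qed.

Lemma tensor_lift0 : tensor_lift 0 = 0.
Proof. by rewrite /tensor_lift (tensor_eq_sum (tensor_reprP _)) big_nil. Qed.

Lemma tensor_lift_unique (f : tensor -> V) :
  {morph f : u v / u + v} -> (forall g h, f (tens g h) = b g h) ->
  f =1 tensor_lift.
Proof.
move=> fD ft; have f0 : f 0 = 0 by apply: (addrI (f 0)); rewrite -fD !addr0.
apply: tensor_ind => [|u v fu fv|g h]; first by rewrite f0 tensor_lift0.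
  by rewrite fD tensor_liftD fu fv.
by rewrite ft tensor_lift_tens.
Qed.
End Lift.

Definition tensor_scale (a : K) : tensor -> tensor :=
  tensor_lift (fun g h => tens (a *: g) h).

Lemma tensor_scale_tens a g h : tensor_scale a (tens g h) = tens (a *: g) h.
Proof.
apply: tensor_lift_tens => [g1 g2 h'|g' h1 h2|c g' h'].
- by rewrite scalerDr tensDl.
- by rewrite tensDr.
- by rewrite scalerA mulrC -scalerA tensZlr.
Qed.

Fact tensor_scaleDr : right_distributive tensor_scale +%R.
Proof.
move=> a u v; apply: tensor_liftD => [g1 g2 h'|g' h1 h2|c g' h'].
- by rewrite scalerDr tensDl.
- by rewrite tensDr.
- by rewrite scalerA mulrC -scalerA tensZlr.
Qed.

Fact tensor_scale0 a : tensor_scale a 0 = 0.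
Proof. by apply: (addrI (tensor_scale a 0)); rewrite -tensor_scaleDr !addr0. Qed.

Fact tensor_scaleA a c u :
  tensor_scale a (tensor_scale c u) = tensor_scale (a * c) u.
Proof.
elim/tensor_ind: u => [|u v IHu IHv|g h]; first by rewrite !tensor_scale0.
  by rewrite !tensor_scaleDr IHu IHv.
by rewrite !tensor_scale_tens scalerA.
Qed.

Fact tensor_scale1 : left_id 1 tensor_scale.
Proof.
elim/tensor_ind=> [|u v IHu IHv|g h]; first by rewrite tensor_scale0.
  by rewrite tensor_scaleDr IHu IHv.
by rewrite tensor_scale_tens scale1r.
Qed.

Fact tensor_scaleDl u : {morph tensor_scale^~ u : a c / a + c}.
Proof.
move=> a c; elim/tensor_ind: u => [|u v IHu IHv|g h].
- by rewrite !tensor_scale0 addr0.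
- by rewrite !tensor_scaleDr IHu IHv addrACA.
- by rewrite !tensor_scale_tens scalerDl tensDl.
Qed.

HB.instance Definition _ := GRing.Zmodule_isLmodule.Build K tensor
  tensor_scaleA tensor_scale1 tensor_scaleDr tensor_scaleDl.

Lemma tensZl a g h : tens (a *: g) h = a *: tens g h.
Proof. by rewrite -tensor_scale_tens. Qed.

Lemma tensZr a g h : tens g (a *: h) = a *: tens g h.
Proof. by rewrite -tensZlr tensZl. Qed.

Definition tensor_one : tensor := tens 1 1.

Definition tensor_mul (u v : tensor) : tensor :=
  tensor_lift (fun g h => tensor_lift (fun g' h' => tens (g * g') (h * h')) v) u.

Let mul_r (g : G) (h : H) (v : tensor) : tensor :=
  tensor_lift (fun g' h' => tens (g * g') (h * h')) v.

Let mul_r_tens g h g' h' : mul_r g h (tens g' h') = tens (g * g') (h * h').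
Proof.
apply: tensor_lift_tens => [? ? ?|? ? ?|? ? ?].
- by rewrite mulrDr tensDl.
- by rewrite mulrDr tensDr.
- by rewrite -!scalerAr tensZlr.
Qed.

Let mul_rD g h : {morph mul_r g h : u v / u + v}.
Proof.
move=> u v; apply: tensor_liftD => [? ? ?|? ? ?|? ? ?].
- by rewrite mulrDr tensDl.
- by rewrite mulrDr tensDr.
- by rewrite -!scalerAr tensZlr.
Qed.

Let mul_r0 g h : mul_r g h 0 = 0.
Proof. by apply: (addrI (mul_r g h 0)); rewrite -mul_rD !addr0. Qed.

Let mul_rDl g g' h v : mul_r (g + g') h v = mul_r g h v + mul_r g' h v.
Proof.
elim/tensor_ind: v => [|u v IHu IHv|g1 h1]; first by rewrite !mul_r0 addr0.
  by rewrite !mul_rD IHu IHv addrACA.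
by rewrite !mul_r_tens mulrDl tensDl.
Qed.

Let mul_rDr g h h' v : mul_r g (h + h') v = mul_r g h v + mul_r g h' v.
Proof.
elim/tensor_ind: v => [|u v IHu IHv|g1 h1]; first by rewrite !mul_r0 addr0.
  by rewrite !mul_rD IHu IHv addrACA.
by rewrite !mul_r_tens mulrDl tensDr.
Qed.

Let mul_rZ a g h v : mul_r (a *: g) h v = mul_r g (a *: h) v.
Proof.
elim/tensor_ind: v => [|u v IHu IHv|g1 h1]; first by rewrite !mul_r0.
  by rewrite !mul_rD IHu IHv.
by rewrite !mul_r_tens -!scalerAl tensZlr.
Qed.

Let mul_tensl g h v : tensor_mul (tens g h) v = mul_r g h v.
Proof.
by apply: (@tensor_lift_tens _ (fun g h => mul_r g h v)) => *;
  rewrite ?mul_rDl ?mul_rDr ?mul_rZ.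
Qed.

Lemma tensor_mul_tens g h g' h' :
  tensor_mul (tens g h) (tens g' h') = tens (g * g') (h * h').
Proof. by rewrite mul_tensl mul_r_tens. Qed.

Fact tensor_mulDl : left_distributive tensor_mul +%R.
Proof.
move=> u u' v.
by apply: (@tensor_liftD _ (fun g h => mul_r g h v)) => *;
  rewrite ?mul_rDl ?mul_rDr ?mul_rZ.
Qed.

Let mul0t v : tensor_mul 0 v = 0.
Proof. by apply: (addrI (tensor_mul 0 v)); rewrite -tensor_mulDl !addr0. Qed.

Fact tensor_mulDr : right_distributive tensor_mul +%R.
Proof.
move=> u v w; elim/tensor_ind: u => [|u u' IHu IHu'|g h].
- by rewrite !mul0t addr0.
- by rewrite !tensor_mulDl IHu IHu' addrACA.
- by rewrite !mul_tensl mul_rD.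
Qed.

Let mult0 v : tensor_mul v 0 = 0.
Proof. by apply: (addrI (tensor_mul v 0)); rewrite -tensor_mulDr !addr0. Qed.

Fact tensor_mulA : associative tensor_mul.
Proof.
move=> u v w; elim/tensor_ind: u => [|u u' IHu IHu'|g1 h1].
- by rewrite !mul0t.
- by rewrite !tensor_mulDl IHu IHu'.
elim/tensor_ind: v => [|v v' IHv IHv'|g2 h2].
- by rewrite mul0t mult0 mul0t.
- by rewrite tensor_mulDl !tensor_mulDr tensor_mulDl IHv IHv'.
elim/tensor_ind: w => [|w w' IHw IHw'|g3 h3].
- by rewrite !mult0.
- by rewrite !tensor_mulDr IHw IHw'.
by rewrite !tensor_mul_tens !mulrA.
Qed.

Fact tensor_mul1l : left_id tensor_one tensor_mul.
Proof.
elim/tensor_ind=> [|u v IHu IHv|g h]; first by rewrite mult0.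
  by rewrite tensor_mulDr IHu IHv.
by rewrite tensor_mul_tens !mul1r.
Qed.

Fact tensor_mul1r : right_id tensor_one tensor_mul.
Proof.
elim/tensor_ind=> [|u v IHu IHv|g h]; first by rewrite mul0t.
  by rewrite tensor_mulDl IHu IHv.
by rewrite tensor_mul_tens !mulr1.
Qed.

End TensorProduct.

(* MathComp algebras are nontrivial, so the algebra structure on the tensor
   product requires 1 (x) 1 != 0, hence a linear form taking the value 1 at 1. *)
Lemma exists_unital_form (K : fieldType) (A : algType K) :
  exists f : A -> K, [/\ {morph f : x y / x + y},
    (forall a x, f (a *: x) = a * f x) & f 1 = 1].
Proof.
pose P (S : set A) :=
  (forall a x y, S x -> S y -> S (a *: x + y)) /\ ~ S 1.
have [M [[Mlin M1] Mmax]] : exists M, P M /\ forall S, (M `<` S)%classic -> ~ P S.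
  apply: Zorn_bigcup => F FP Ftot; split=> [a x y [S FS Sx] [S' FS' S'y]|].
    have [SS'|S'S] := Ftot _ _ FS FS'.
      by exists S' => //; apply: (FP _ FS').1 => //; apply: SS'.
    by exists S => //; apply: (FP _ FS).1 => //; apply: S'S.
  by move=> [S FS S1]; apply: (FP _ FS).2.
have M0 : M 0.
  apply: contrapT => nM0.
  have nM x : ~ M x.
    by move=> Mx; apply: nM0; rewrite -(addNr x) -scaleN1r; apply: Mlin.
  apply: (Mmax [set 0]%classic).
    by split=> [x /nM//|/(_ 0 erefl)].
  split=> [a x y -> ->|/eqP]; first by rewrite scaler0 addr0.
  by rewrite oner_eq0.
have MZ a x : M x -> M (a *: x) by move=> Mx; rewrite -[_ *: _]addr0; apply: Mlin.
have MD x y : M x -> M y -> M (x + y).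
  by move=> Mx My; rewrite -[x]scale1r; apply: Mlin.
have MB x y : M x -> M y -> M (x - y).
  by move=> Mx My; rewrite addrC -scaleN1r; apply: Mlin.
have ex x : exists c : K, M (x - c *: 1).
  apply: contrapT => nex.
  pose S : set A := [set y | exists c : K, M (y - c *: x)]%classic.
  have MS : (M `<=` S)%classic by move=> y My; exists 0; rewrite scale0r subr0.
  have nMx : ~ M x by move=> Mx; apply: nex; exists 0; rewrite scale0r subr0.
  apply: (Mmax S).
    split=> // /(_ x) SM; apply: nMx; apply: SM.
    by exists 1; rewrite scale1r subrr.
  split=> [a y z [c My] [d Mz]|[c Mc]].
    exists (a * c + d); rewrite scalerDl -scalerA opprD addrACA -scalerBr.
    exact: Mlin.
  have [c0|cN0] := eqVneq c 0; first by apply: M1; rewrite c0 scale0r subr0 in Mc.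
  apply: nex; exists c^-1; have := MZ (- c^-1) _ Mc.
  by rewrite scalerBr scalerA mulNr mulVf // !scaleNr scale1r opprK addrC.
have uniq x c d : M (x - c *: 1) -> M (x - d *: 1) -> c = d.
  move=> Mc Md; apply/eqP; rewrite -subr_eq0; apply: contrapT => /negP cd.
  apply: M1; have := MZ (c - d)^-1 _ (MB _ _ Md Mc).
  rewrite opprB [x - _ + _]addrC addrA subrK -scalerBl scalerA mulVf //.
  by rewrite scale1r.
pose f x := sval (cid (ex x)); have fP x : M (x - f x *: 1) := svalP (cid (ex x)).
exists f; split=> [x y|a x|].
- apply: (uniq (x + y)) => //.
  by rewrite scalerDl opprD addrACA; apply: MD.
- by apply: (uniq (a *: x)) => //; rewrite -scalerA -scalerBr; apply: MZ.
- by apply: (uniq 1) => //; rewrite scale1r subrr.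
Qed.

Section TensorAlgebra.
Variables (K : fieldType) (G H : algType K).

Fact tensor_one_neq0 : tensor_one G H != 0.
Proof.
have [f [fD fZ f1]] := exists_unital_form G.
have [e [eD eZ e1]] := exists_unital_form H.
pose b g h : K := f g * e h.
have bDl g g' h : b (g + g') h = b g h + b g' h by rewrite /b fD mulrDl.
have bDr g h h' : b g (h + h') = b g h + b g h' by rewrite /b eD mulrDr.
have bZ a g h : b (a *: g) h = b g (a *: h) by rewrite /b fZ eZ mulrCA mulrA.
apply/eqP => /(congr1 (tensor_lift b)).
rewrite tensor_lift_tens // tensor_lift0 // /b f1 e1 mulr1.
by move/eqP; rewrite oner_eq0.
Qed.

HB.instance Definition _ := GRing.Zmodule_isNzRing.Build (tensor G H)
  (@tensor_mulA K G H) (@tensor_mul1l K G H) (@tensor_mul1r K G H)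
  (@tensor_mulDl K G H) (@tensor_mulDr K G H) tensor_one_neq0.

Lemma tensM (g g' : G) (h h' : H) :
  tens g h * tens g' h' = tens (g * g') (h * h').
Proof. exact: tensor_mul_tens. Qed.

Fact tensor_scaleAl (a : K) (u v : tensor G H) : a *: (u * v) = a *: u * v.
Proof.
elim/tensor_ind: u => [|u u' IHu IHu'|g1 h1].
- by rewrite scaler0 !mul0r scaler0.
- by rewrite mulrDl !scalerDr mulrDl IHu IHu'.
elim/tensor_ind: v => [|v v' IHv IHv'|g2 h2].
- by rewrite !mulr0 scaler0.
- by rewrite !mulrDr scalerDr IHv IHv'.
by rewrite -tensZl !tensM -tensZl scalerAl.
Qed.

HB.instance Definition _ :=
  GRing.Lmodule_isLalgebra.Build K (tensor G H) tensor_scaleAl.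

Fact tensor_scaleAr (a : K) (u v : tensor G H) : a *: (u * v) = u * (a *: v).
Proof.
elim/tensor_ind: u => [|u u' IHu IHu'|g1 h1].
- by rewrite !mul0r scaler0.
- by rewrite !mulrDl scalerDr IHu IHu'.
elim/tensor_ind: v => [|v v' IHv IHv'|g2 h2].
- by rewrite scaler0 !mulr0 scaler0.
- by rewrite scalerDr !mulrDr scalerDr IHv IHv'.
by rewrite -tensZl !tensM -tensZl scalerAr.
Qed.

HB.instance Definition _ :=
  GRing.Lalgebra_isAlgebra.Build K (tensor G H) tensor_scaleAr.

End TensorAlgebra.

Section LieIdentities.
Variables (K : fieldType) (A : algType K).

Definition lie (u v : A) : A := u * v - v * u.

(* Variables are numbered from 0: [long_comm x p] is the commutator
   [x_0, ..., x_p], of length p + 1. *)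
Fixpoint long_comm (x : nat -> A) (p : nat) : A :=
  if p is p'.+1 then lie (long_comm x p') (x p) else x 0%N.

(* The identity [x_1, ..., x_(p+1)] = 0. *)
Definition lie_identity (p : nat) : Prop :=
  forall x : nat -> A, long_comm x p = 0.

Definition lie_nilpotent : Prop :=
  exists p : nat, (1 <= p)%N /\ lie_identity p.

Definition lie_nilpotent_index (p : nat) : Prop :=
  [/\ (1 <= p)%N, lie_identity p & ~ lie_identity p.-1].

(* The identity [x_1, x_2] [x_3, x_4] ... [x_(2k-1), x_(2k)] = 0. *)
Definition comm_prod_identity (k : nat) : Prop :=
  forall x : nat -> A, \prod_(i < k) lie (x i.*2) (x i.*2.+1) = 0.

Definition min_lie_identity (q : nat) : Prop :=
  lie_identity q /\ forall r : nat, lie_identity r -> (q <= r)%N.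

End LieIdentities.

Arguments lie_identity {K} A p.
Arguments lie_nilpotent {K} A.
Arguments lie_nilpotent_index {K} A p.
Arguments comm_prod_identity {K} A k.
Arguments min_lie_identity {K} A q.

(* Main.v *)
(* Let T^(m) be the ideal generated by the commutators of length m. Latyshev's
   inclusion T^(m) T^(n) <= T^(m+n-2) shows that a product of r commutators of
   lengths l_1, ..., l_r >= 2 vanishes in G (resp. H) once its weight
   w = sum_i (l_i - 2) reaches p_1 - 1 (resp. p_2 - 1) and r > 0, and it also
   vanishes in H once r >= k. Expand a long commutator of G (x) H into terms
   u y (x) v z, where y and z are such products. A further bracket with g (x) h
   raises w(y), r(z) or w(z), except when it turns u into the factor [u, g],
   which cannot happen again before a bracket on the H side has supplied a new
   coefficient. Hence every bracket raises the potential
     w(y) + 2 (r(z) + w(z)) + [no coefficient u],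
   which is at most max(p_1, 2) - 2 + 2 (p_2 + k - 3) + 1 on nonzero terms. This
   gives q <= max(p_1, 2) + 2 p_2 + 2 k - 6 in every characteristic, which is
   below both upper bounds. For the lower bound, g |-> g (x) 1 and
   h |-> 1 (x) h are split by unital linear forms. *)

Require Import Defs.
From HB Require Import structures.
From mathcomp Require Import all_boot all_algebra.
From mathcomp Require Import zify.

Set Implicit Arguments.
Unset Strict Implicit.
Unset Printing Implicit Defensive.

Import GRing.Theory.
Local Open Scope ring_scope.

(** * Additive subgroups generated by a set *)

Section AdditiveSpan.
Variable V : zmodType.
Implicit Types (S : V -> Prop) (x y : V).

Inductive zspan S : V -> Prop :=
| zspan_gen x : S x -> zspan S x
| zspan0 : zspan S 0
| zspanB x y : zspan S x -> zspan S y -> zspan S (x - y).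

Lemma zspanN S x : zspan S x -> zspan S (- x).
Proof. by rewrite -sub0r; apply: zspanB; apply: zspan0. Qed.

Lemma zspanD S x y : zspan S x -> zspan S y -> zspan S (x + y).
Proof. by move=> Sx Sy; rewrite -[y]opprK; apply/zspanB/zspanN. Qed.

Lemma zspan_vanish S x : (forall y, S y -> y = 0) -> zspan S x -> x = 0.
Proof. by move=> S0; elim=> [y /S0|//|y z _ -> _ ->]; rewrite ?subr0. Qed.

End AdditiveSpan.

Lemma zspan_image (V W : zmodType) (f : V -> W) S S' x :
    {morph f : y z / y - z} -> (forall y, S y -> zspan S' (f y)) ->
  zspan S x -> zspan S' (f x).
Proof.
move=> fB fS; elim=> [y /fS // | | y z _ IHy _ IHz].
  by rewrite -(subrr 0) fB subrr; apply: zspan0.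
by rewrite fB; apply: zspanB.
Qed.

(** * Commutator identities and Latyshev's inclusion *)

Section Latyshev.
Variables (K : fieldType) (A : algType K).
Implicit Types (x y z u v a b c d f : A) (X : nat -> A) (m n : nat).

Lemma lieBl u v w : lie (u - v) w = lie u w - lie v w :> A.
Proof.
by rewrite /lie mulrBl mulrBr !opprB addrACA [RHS]addrACA [- (v * w) - _]addrC.
Qed.

Lemma lieDr u v w : lie w (u + v) = lie w u + lie w v :> A.
Proof. by rewrite /lie mulrDl mulrDr opprD addrACA. Qed.

Lemma lieBr u v w : lie w (u - v) = lie w u - lie w v :> A.
Proof.
by rewrite /lie mulrBl mulrBr !opprB addrACA [RHS]addrACA [- (w * v) - _]addrC.
Qed.

Lemma lieMl u v w : lie (u * v) w = lie u w * v + u * lie v w :> A.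
Proof.
by rewrite /lie mulrBl mulrBr !mulrA [RHS]addrC addrA subrK.
Qed.

Lemma lieMr u v w : lie w (u * v) = lie w u * v + u * lie w v :> A.
Proof.
by rewrite /lie mulrBl mulrBr !mulrA addrA subrK.
Qed.

Lemma lie_lier u v w : lie u (lie v w) = lie (lie u v) w - lie (lie u w) v :> A.
Proof.
rewrite {2}/lie lieBr !lieMr opprD [- _ - _]addrC addrACA.
by rewrite [lie (lie u v) w]/lie [lie (lie u w) v]/lie opprB.
Qed.

(* The index counts brackets: [lc n] concerns commutators of length [n + 1], and
   [lideal n] is the ideal usually written T^(n+1). *)
Definition lc n : A -> Prop := zspan (fun c => exists X, c = long_comm X n).

Definition lideal n : A -> Prop :=
  zspan (fun x => exists u v X, x = u * long_comm X n * v).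

Lemma lc_ind n (P : A -> Prop) :
  P 0 -> (forall x y, P x -> P y -> P (x - y)) ->
  (forall X, P (long_comm X n)) -> forall c, lc n c -> P c.
Proof.
by move=> P0 PB Pg c; elim=> [_ [X ->] | | x y _ Px _ Py] //; apply: PB.
Qed.

Lemma lc_lie n c y : lc n c -> lc n.+1 (lie c y).
Proof.
move=> Lc; apply: (zspan_image (f := fun c => lie c y)) Lc => [a b|_ [X ->]].
  exact: lieBl.
pose Y i := if (i <= n)%N then X i else y.
apply: zspan_gen; exists Y => /=; rewrite {2}/Y ltnn; congr lie.
suff XY i : (i <= n)%N -> long_comm X i = long_comm Y i by apply: XY.
by elim: i => //= i IHi lt_in; rewrite {2}/Y lt_in -IHi // ltnW.
Qed.

Lemma lc0 x : lc 0 x.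
Proof. by apply: zspan_gen; exists (fun=> x). Qed.

Lemma lcS_ind n (P : A -> Prop) :
  P 0 -> (forall x y, P x -> P y -> P (x - y)) ->
  (forall c y, lc n c -> P (lie c y)) -> forall c, lc n.+1 c -> P c.
Proof.
move=> P0 PB Pl; apply: lc_ind => // X; apply: Pl.
by apply: zspan_gen; exists X.
Qed.

(** By the Jacobi identity, [x,[y,f]] = [[x,y],f] - [[x,f],y], where the brackets with [y] have a
    right entry of degree one less than [y,f]. *)
Lemma lie_lc m n x y : lc m x -> lc n y -> lc (m + n).+1 (lie x y).
Proof.
move=> Lx Ly; elim: n y Ly m x Lx => [|n IHn] y Ly m x Lx.
  by rewrite addn0; apply: lc_lie.
elim/lcS_ind: y / Ly => [|a b La Lb|y f Ly].
- by rewrite /lie mulr0 mul0r subrr; apply: zspan0.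
- by rewrite lieBr; apply: zspanB.
rewrite lie_lier addnS; apply: zspanB; first by apply/lc_lie/IHn.
by rewrite -addSn; apply/IHn/lc_lie.
Qed.

Lemma lidealMl n u x : lideal n x -> lideal n (u * x).
Proof.
apply: zspan_image => [a b|_ [v [w [X ->]]]]; first by rewrite mulrBr.
by apply: zspan_gen; exists (u * v), w, X; rewrite !mulrA.
Qed.

Lemma lidealMr n u x : lideal n x -> lideal n (x * u).
Proof.
apply: (zspan_image (f := *%R^~ u)) => [a b|_ [v [w [X ->]]]].
  by rewrite mulrBl.
by apply: zspan_gen; exists v, (w * u), X; rewrite !mulrA.
Qed.

Lemma lc_lideal n c : lc n c -> lideal n c.
Proof.
apply: (zspan_image (f := id)) => [//|_ [X ->]].
by apply: zspan_gen; exists 1, 1, X; rewrite mul1r mulr1.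
Qed.

(** Since [c,y] = cy - yc, a further bracket stays in the ideal of c. *)
Lemma lideal_le m n x : (m <= n)%N -> lideal n x -> lideal m x.
Proof.
move/subnK <-; elim: (n - m)%N => // k IHk Tx; apply: IHk.
elim: Tx => [_ [u [v [X ->]]] | | a b _ Ta _ Tb].
- apply/lidealMr/lidealMl.
  have Lc : lideal (k + m) (long_comm X (k + m)).
    by apply: lc_lideal; apply: zspan_gen; exists X.
  by rewrite addSn /=; apply: zspanB; [apply: lidealMr | apply: lidealMl].
- exact: zspan0.
- exact: zspanB.
Qed.

(* The remainder that appears when [ [c', y z] = [c', y] z + y [c', z] ] is
   bracketed repeatedly: products of total degree [t + 1] with a factor of
   degree less than [n] are handled by induction on [n]. *)
Definition remainder t n : A -> Prop :=
  zspan (fun e => lc t e \/ exists a b i j,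
    [/\ e = a * b, lc i a, lc j b, (i + j = t.+1)%N & (i < n)%N || (j < n)%N]).

Lemma remainder_lie t n x f : remainder t n x -> remainder t.+1 n.+1 (lie x f).
Proof.
move=> Rx; apply: (zspan_image (f := fun x => lie x f)) Rx => [a b|e].
  exact: lieBl.
case=> [Le|[a [b [i [j [-> La Lb def_t lt_n]]]]]].
  by apply: zspan_gen; left; apply: lc_lie.
rewrite lieMl; apply: zspanD; apply: zspan_gen; right.
  by exists (lie a f), b, i.+1, j; split=> //; [apply: lc_lie | lia | lia].
by exists a, (lie b f), i, j.+1; split=> //; [apply: lc_lie | lia | lia].
Qed.

(** The identity c[d,f] = [cd,f] - [c,f]d lowers the degree of the right factor, and [c,f]d is
    itself an admissible remainder term. *)
Lemma lcM_remainder m n c d :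
  lc m.+1 c -> lc n.+1 d -> remainder (m + n).+1 n.+1 (c * d).
Proof.
move=> Lc; elim: n d => [|n IHn] d Ld.
  elim/lcS_ind: c / Lc => [|a b Ra Rb|c y Lc].
  - by rewrite mul0r; apply: zspan0.
  - by rewrite mulrBl; apply: zspanB.
  have ->: lie c y * d = lie c (y * d) - y * lie c d by rewrite lieMr addrK.
  apply: zspanB; apply: zspan_gen; rewrite addn0; first by left; apply: lc_lie.
  right; exists y, (lie c d), 0%N, m.+2; split=> //; first exact: lc0.
  by rewrite -[m.+1]addn1; apply: lie_lc.
elim/lcS_ind: d / Ld => [|a b Ra Rb|d f Ld].
- by rewrite mulr0; apply: zspan0.
- by rewrite mulrBr; apply: zspanB.
have ->: c * lie d f = lie (c * d) f - lie c f * d by rewrite lieMl addrC addKr.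
apply: zspanB; first by rewrite addnS; apply/remainder_lie/IHn.
apply: zspan_gen; right; exists (lie c f), d, m.+2, n.+1.
by split; [| exact: lc_lie | | lia | lia].
Qed.

(** Strong induction on [n]: a remainder product ab has total degree m + n and a factor of degree
    below [n]; if that factor is a, swapping costs only [a,b], of degree m + n + 1. *)
Lemma lcM m n c d : lc m c -> lc n d -> lideal (m + n).-1 (c * d).
Proof.
elim/ltn_ind: n m c d => n IHn m c d Lc Ld.
case: m Lc => [|m] Lc.
  by apply/(lideal_le (leq_pred _))/lidealMl/lc_lideal.
case: n => [|n] in Ld IHn *.
  by rewrite addn0; apply/(lideal_le (leq_pred _))/lidealMr/lc_lideal.
rewrite addSn addnS /=.
elim: (lcM_remainder Lc Ld) => [e | | x y _ Tx _ Ty];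
  [|exact: zspan0|exact: zspanB].
case=> [/lc_lideal // | [a [b [i [j [-> La Lb def_t]]]]]].
case/orP=> lt_n; last by have := IHn _ lt_n _ _ _ La Lb; rewrite def_t.
have ->: a * b = b * a + lie a b by rewrite addrC subrK.
apply: zspanD; first by have := IHn _ lt_n _ _ _ Lb La; rewrite addnC def_t.
by have := lc_lideal (lie_lc La Lb); apply: lideal_le; lia.
Qed.

Lemma lidealM m n x y :
  lideal m x -> lideal n y -> lideal (m + n).-1 (x * y).
Proof.
move=> Tx Ty; apply: (zspan_image (f := *%R^~ y) _ _ Tx) => [a b|].
  by rewrite mulrBl.
move=> _ [u [v [X ->]]].
apply: (zspan_image (f := *%R (u * long_comm X m * v)) _ _ Ty) => [a b|].
  by rewrite mulrBr.
move=> _ [u' [v' [Y ->]]].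
set c := long_comm X m; set d := long_comm Y n.
have Lc : lc m c by apply: zspan_gen; exists X.
have Ld : lc n d by apply: zspan_gen; exists Y.
have ->: u * c * v * (u' * d * v') = u * (c * (v * u') * d) * v'.
  by rewrite !mulrA.
apply/lidealMr/lidealMl.
(* Moving the middle coefficient out leaves a bracket of [c], of degree one higher. *)
have ->: c * (v * u') * d = v * u' * (c * d) + lie c (v * u') * d.
  by rewrite /lie mulrBl !mulrA addrC subrK.
apply: zspanD; first exact/lidealMl/lcM.
by have := lcM (lc_lie (v * u') Lc) Ld; apply: lideal_le; lia.
Qed.

(** * Vanishing of commutator ideals and of products of commutators *)

Lemma lie_identity_lideal p n x :
  lie_identity A p -> (p <= n)%N -> lideal n x -> x = 0.
Proof.
move=> Ap le_pn /(lideal_le le_pn); apply: zspan_vanish => _ [u [v [X ->]]].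
by rewrite Ap mulr0 mul0r.
Qed.

Lemma lie_identity_le p n : (p <= n)%N -> lie_identity A p -> lie_identity A n.
Proof.
move=> le_pn Ap X; apply: (lie_identity_lideal Ap le_pn).
by apply: lc_lideal; apply: zspan_gen; exists X.
Qed.

(* [cprod r w] is spanned by the products of [r] commutators of lengths
   [l_1, ..., l_r >= 2] with [sum_i (l_i - 2) = w]. *)
Inductive cprod : nat -> nat -> A -> Prop :=
| cprod1 : cprod 0 0 1
| cprodM r w j c x : lc j.+1 c -> cprod r w x -> cprod r.+1 (j + w) (c * x)
| cprod0 r w : cprod r w 0
| cprodB r w x y : cprod r w x -> cprod r w y -> cprod r w (x - y).

Lemma cprodD r w x y : cprod r w x -> cprod r w y -> cprod r w (x + y).
Proof.
move=> Px Py; rewrite -[y]opprK; apply: cprodB => //.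
by rewrite -sub0r; apply: cprodB => //; apply: cprod0.
Qed.

Lemma cprod_lie r w x f : cprod r w x -> cprod r w.+1 (lie x f).
Proof.
elim=> [|{}r {}w j c {}x Lc Px IHx|{}r {}w|{}r {}w {}x y _ IHx _ IHy].
- by rewrite /lie mul1r mulr1 subrr; apply: cprod0.
- rewrite lieMl; apply: cprodD; last by rewrite -addnS; apply: cprodM.
  by rewrite -addSn; apply: cprodM => //; apply: lc_lie.
- by rewrite /lie mul0r mulr0 subrr; apply: cprod0.
- by rewrite lieBl; apply: cprodB.
Qed.

Lemma cprod_lieM r w u f x : cprod r w x -> cprod r.+1 w (lie u f * x).
Proof. by apply: (@cprodM _ _ 0); apply/lc_lie/lc0. Qed.

(** Each factor adds [j], by Latyshev's inclusion at indices j + 1 and w + 1. The hypothesis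
    excludes the empty product 1. *)
Lemma cprod_lideal r w x : cprod r w x -> (0 < r + w)%N -> lideal w.+1 x.
Proof.
elim=> [//|{}r {}w j c {}x Lc Px IHx _|{}r {}w _|{}r {}w {}x y _ IHx _ IHy lt0].
- have [/IHx Tx|] := ltnP 0 (r + w).
    by have := lidealM (lc_lideal Lc) Tx; rewrite addSn addnS.
  rewrite leqn0 addn_eq0 => /andP[_ /eqP->]; rewrite addn0.
  exact/lidealMr/lc_lideal.
- exact: zspan0.
- by apply: zspanB; [apply: IHx | apply: IHy].
Qed.

Lemma comm_prod_cprod k r w x :
  comm_prod_identity A k -> (k <= r)%N -> cprod r w x -> x = 0.
Proof.
move=> Ak le_kr Px.
(* A prefix of [m] brackets is added, into which the induction moves the factors of [x] one by
   one. *)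
suff Px0 m X : (k <= m + r)%N -> \prod_(i < m) lie (X i.*2) (X i.*2.+1) * x = 0.
  by have := Px0 0%N (fun=> 0); rewrite big_ord0 mul1r; apply.
elim: Px m X {le_kr} => [|{}r {}w j c {}x Lc Px IHx|{}r {}w
  |{}r {}w {}x y _ IHx _ IHy] m X le_k.
- rewrite mulr1; move: le_k; rewrite addn0 => /subnKC def_m.
  by rewrite -def_m big_split_ord /= Ak mul0r.
- elim/lcS_ind: c / Lc => [|a b IHa IHb|c y _]; rewrite ?mul0r ?mulr0 //.
    by rewrite mulrBl mulrBr IHa IHb subrr.
  pose Y i := if (i < m.*2)%N then X i else if i == m.*2 then c else y.
  have := IHx m.+1 Y; rewrite addSnnS => /(_ le_k) <-.
  rewrite big_ord_recr /= mulrA /Y ltnn eqxx ltnNge leqnSn /= eqn_leq ltnn /=.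
  congr (_ * _ * _); apply: eq_bigr => i _; have lt_im := ltn_ord i.
  by rewrite !ifT //; lia.
- by rewrite mulr0.
- by rewrite mulrBr IHx // IHy // subrr.
Qed.

End Latyshev.

(** * Long commutators in the tensor product *)

Section TensorBound.
Variables (K : fieldType) (G H : algType K).

Lemma tens0l h : tens 0 h = 0 :> tensor G H.
Proof. by rewrite -(scale0r 0) tensZl scale0r. Qed.

Lemma tens0r g : tens g 0 = 0 :> tensor G H.
Proof. by rewrite -(scale0r 0) tensZr scale0r. Qed.

Lemma lie_tens (a g : G) (b h : H) :
  lie (tens a b) (tens g h) = tens (lie a g) (h * b) + tens (a * g) (lie b h).
Proof.
have tensBl x y z : tens (x - y) z = tens x z - tens y z :> tensor G H.
  by rewrite tensDl -!scaleN1r tensZl.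
have tensBr x y z : tens z (x - y) = tens z x - tens z y :> tensor G H.
  by rewrite tensDr -!scaleN1r tensZr.
by rewrite /lie !tensM tensBl tensBr [RHS]addrC addrA subrK.
Qed.

(* The disjunct [u = 1] is the case of an absent coefficient, worth one more. *)
Definition weighted N : tensor G H -> Prop := zspan (fun t =>
  exists (u y : G) (v z : H) (r w r' w' : nat),
    [/\ t = tens (u * y) (v * z), cprod r w y, cprod r' w' z
      & (N <= w + 2 * (r' + w'))%N
        \/ u = 1 /\ (N <= w + 2 * (r' + w') + 1)%N]).

Lemma weighted_gen N (u y : G) (v z : H) r w r' w' :
    cprod r w y -> cprod r' w' z -> (N <= w + 2 * (r' + w'))%N ->
  weighted N (tens (u * y) (v * z)).
Proof.
move=> Py Pz leN; apply: zspan_gen.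
by exists u, y, v, z, r, w, r', w'; split=> //; left.
Qed.

Lemma weighted_gen1 N (y : G) (v z : H) r w r' w' :
    cprod r w y -> cprod r' w' z -> (N <= w + 2 * (r' + w') + 1)%N ->
  weighted N (tens y (v * z)).
Proof.
move=> Py Pz leN; apply: zspan_gen.
by exists 1, y, v, z, r, w, r', w'; rewrite mul1r; split=> //; right.
Qed.

Lemma weighted_lie N t s : weighted N t -> weighted N.+1 (lie t s).
Proof.
elim/tensor_ind: s => [_|s s' IHs IHs' /[dup]/IHs Ws /IHs' Ws'|g h].
- by rewrite /lie mulr0 mul0r subrr; apply: zspan0.
- by rewrite lieDr; apply: zspanD.
move=> Wt; apply: (zspan_image (f := fun t => lie t (tens g h))) Wt.
  by move=> a b; apply: lieBl.
move=> _ [u [y [v [z [r [w [r' [w' [-> Py Pz leN]]]]]]]]].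
have Pyg := cprod_lie g Py; have Pzh := cprod_lie h Pz.
have Pvz := cprod_lieM v h Pz; have Puy := cprod_lieM u g Py.
rewrite lie_tens mulrA; apply: zspanD.
  case: leN => [leN|[-> leN]]; last first.
    by rewrite mul1r; apply: weighted_gen1 Pyg Pz _; lia.
  rewrite lieMl tensDl; apply: zspanD.
    (* [u,g] joins [y] without raising its weight; the coefficient becoming absent supplies the
       gain. *)
    by apply: weighted_gen1 Puy Pz _; lia.
  by apply: weighted_gen Pyg Pz _; lia.
(* A gain of two on the H side pays for this bracket and for losing the bonus of an absent
   coefficient. *)
have leN' : (N.+1 <= w + 2 * (r' + w').+1)%N by lia.
have ->: u * y * g = u * g * y + u * lie y g.
  by rewrite /lie mulrBr !mulrA addrC subrK.
rewrite lieMl -[lie v h * z]mul1r tensDl 2!tensDr.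
by apply: zspanD; apply: zspanD;
  do [apply: weighted_gen Py Pvz _ | apply: weighted_gen Py Pzh _
    | apply: weighted_gen Pyg Pvz _ | apply: weighted_gen Pyg Pzh _]; lia.
Qed.

Lemma weighted_long_comm X n : weighted n (long_comm X n).
Proof.
elim: n => [|n IHn] /=; last exact: weighted_lie.
elim/tensor_ind: (X 0%N) => [|s t Ws Wt|g h].
- exact: zspan0.
- exact: zspanD.
rewrite -[g]mulr1 -[h]mulr1.
by apply: weighted_gen; [apply: cprod1 | apply: cprod1 | ].
Qed.

Lemma lie_identity_tensor p1 p2 k n :
    lie_identity G p1 -> (1 < p1)%N -> lie_identity H p2 ->
    comm_prod_identity H k -> (1 < k)%N -> (0 < p2)%N ->
    (p1 + 2 * p2 + 2 * k <= n + 6)%N ->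
  lie_identity (tensor G H) n.
Proof.
move=> Gp1 p1_gt1 Hp2 Hk k_gt1 p2_gt0 len X.
apply: zspan_vanish (weighted_long_comm X n) => t.
move=> [u [y [v [z [r [w [r' [w' [-> Py Pz leN]]]]]]]]].
have [le_p1w|lt_wp1] := leqP p1 w.+1.
  (* Here p1 > 1 forces w > 0, so [y] is not an empty product. *)
  have Ty : lideal w.+1 y by apply: cprod_lideal Py _; lia.
  by rewrite (lie_identity_lideal Gp1 le_p1w Ty) mulr0 tens0l.
have [le_kr|lt_rk] := leqP k r'.
  by rewrite (comm_prod_cprod Hk le_kr Pz) mulr0 tens0r.
(* Now w <= p1 - 2 and r' <= k - 1, so the potential forces w' >= p2 - 1; when p2 = 1, k >= 2 still
   gives r' + w' > 0. *)
have Tz : lideal w'.+1 z by apply: cprod_lideal Pz _; lia.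
have le_p2w : (p2 <= w'.+1)%N by lia.
by rewrite (lie_identity_lideal Hp2 le_p2w Tz) mulr0 tens0r.
Qed.

Lemma lie_identity_tensl n : lie_identity (tensor G H) n -> lie_identity G n.
Proof.
move=> GHn X; have [e [eD eZ e1]] := exists_unital_form H.
pose b g h := e h *: g : G.
have bDl g g' h : b (g + g') h = b g h + b g' h by rewrite /b scalerDr.
have bDr g h h' : b g (h + h') = b g h + b g h' by rewrite /b eD scalerDl.
have bZ a g h : b (a *: g) h = b g (a *: h).
  by rewrite /b eZ scalerA mulrC.
have tensX m :
    long_comm (fun i => tens (X i) 1) m = tens (long_comm X m) 1 :> tensor G H.
  elim: m => [|m IHm] //=; rewrite IHm lie_tens mulr1.
  by rewrite [lie 1 1]/lie mulr1 subrr tens0r addr0.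
have := GHn (fun i => tens (X i) 1); rewrite tensX => /(congr1 (tensor_lift b)).
by rewrite tensor_lift_tens // tensor_lift0 // /b e1 scale1r.
Qed.

Lemma lie_identity_tensr n : lie_identity (tensor G H) n -> lie_identity H n.
Proof.
move=> GHn X; have [e [eD eZ e1]] := exists_unital_form G.
pose b g h := e g *: h : H.
have bDl g g' h : b (g + g') h = b g h + b g' h by rewrite /b eD scalerDl.
have bDr g h h' : b g (h + h') = b g h + b g h' by rewrite /b scalerDr.
have bZ a g h : b (a *: g) h = b g (a *: h).
  by rewrite /b eZ scalerA mulrC.
have tensX m :
    long_comm (fun i => tens 1 (X i)) m = tens 1 (long_comm X m) :> tensor G H.
  elim: m => [|m IHm] //=; rewrite IHm lie_tens mulr1.
  by rewrite [lie 1 1]/lie mulr1 subrr tens0l add0r.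
have := GHn (fun i => tens 1 (X i)); rewrite tensX => /(congr1 (tensor_lift b)).
by rewrite tensor_lift_tens // tensor_lift0 // /b e1 scale1r.
Qed.

End TensorBound.

(** * Comparison of indices and the final bounds *)

Lemma lie_index_le (K : fieldType) (A : algType K) p q :
  lie_nilpotent_index A p -> lie_identity A q -> (p <= q)%N.
Proof.
case=> p_gt0 _ Ap Aq; rewrite leqNgt; apply/negP => lt_qp; apply: Ap.
by apply: lie_identity_le Aq; rewrite -ltnS prednK.
Qed.

Theorem theorem2p5 (K : fieldType) (G H : algType K) (p1 p2 k : nat)
    (hG : lie_nilpotent_index G p1) (hH : lie_nilpotent_index H p2)
    (hk : (2 <= k)%N) (hHk : comm_prod_identity H k) :
  lie_nilpotent (tensor G H) /\
  forall q : nat, min_lie_identity (tensor G H) q ->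
    (maxn p1 p2 <= q <= 4 * (p1 + p2 + k - 2))%N /\
    (3%N \notin [pchar K]%R ->
     (maxn p1 p2 <= q <=
        4 * (uphalf (p1 - 1) + uphalf (p2 - 1) + k))%N).
Proof.
have [p1_gt0 Gp1 _] := hG; have [p2_gt0 Hp2 _] := hH.
(* A commutative G is treated as having index bound 2, as the weight argument asks for p1 > 1. The
   subtraction does not truncate, since P1 >= 2, p2 >= 1 and k >= 2. *)
pose P1 := maxn p1 2; pose n := (P1 + 2 * p2 + 2 * k - 6)%N.
have GP1 : lie_identity G P1 by apply: lie_identity_le Gp1; rewrite leq_maxl.
have GHn : lie_identity (tensor G H) n.
  by apply: lie_identity_tensor GP1 _ Hp2 hHk hk p2_gt0 _; lia.
split=> [|q [GHq q_min]]; first by exists n; split=> //; lia.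
have le_pq : (maxn p1 p2 <= q)%N.
  rewrite geq_max (lie_index_le hG (lie_identity_tensl GHq)).
  exact: lie_index_le hH (lie_identity_tensr GHq).
have le_qn := q_min _ GHn; rewrite le_pq /=; split=> [|_]; lia.
Qed.
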